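(* Let $d\ge 2$ and let $f_d(x,y) = \sum_{i=0}^{d}\sum_{j=0}^{d} A_{(i,j)} x^i y^j \in \mathbb{C}[x,y]$ be a degree $d$ polynomial correspondence that is a map of $d$-tuples and that cannot be written as $f_d(x,y) = [g_k(x,y)]^{d/k}$ where $k\mid d$, $k\neq d$, and $g_k\in\mathbb{C}[x,y]$ is a map of $k$-tuples. Then the following statements are equivalent. (1) $f_d(x,y)=0$ if and only if $f_d(\overline{x},\overline{y})=0$. (2) There exists a factorisation of $f_d=0$ as $\Phi(x)=\Psi(y)$ with $$\Phi(x) = \frac{\kappa_d x^d + \cdots + \kappa_1 x + \kappa_0}{\lambda_d x^d + \cdots + \lambda_1 x + \lambda_0}, \qquad \Psi(y) = \frac{\mu_d y^d + \cdots + \mu_1 y + \mu_0}{\nu_d y^d + \cdots + \nu_1 y + \nu_0}$$ fractional degree $d$ functions, where the coefficients $\kappa_i,\lambda_i,\mu_i,\nu_i$, $0\le i\le d$, are real. (3) The matrix of coefficients of $f_d$ is real (up to multiplication by a constant).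
   Context: $\widehat{\mathbb{C}} = \mathbb{C}\cup\{\infty\}$ is the Riemann sphere; $\widehat{\mathbb{C}}_x$ and $\widehat{\mathbb{C}}_y$ denote the copies in which $x$ and $y$ range. The bar denotes complex conjugation, with $\overline{\infty}=\infty$. Degree $n$ polynomial correspondence ($n\ge 1$): a polynomial $f(x,y)=\sum_{0\le i,j\le n}A_{(i,j)}x^iy^j\in\mathbb{C}[x,y]$, of degree $n$ in each of the two variables, such that (1) $f(x,\cdot)$ and $f(\cdot,y)$ are generically $n$-valued (counting multiplicity), and (2) the biprojective completion $\Gamma_f$ of $\{f=0\}$ in $\widehat{\mathbb{C}}_x\times\widehat{\mathbb{C}}_y$ (the zero set of the bihomogenisation of $f$ of bidegree $(n,n)$) has no irreducible component of the form $\{a\}\times\widehat{\mathbb{C}}_y$ or $\widehat{\mathbb{C}}_x\times\{a\}$ with $a\in\widehat{\mathbb{C}}$. For $x,y$ in the Riemann sphere, $f(x,y)=0$ means $(x,y)\in\Gamma_f$; statements of the form ''$f(x,y)=0$ iff ...'' are for all such $x,y$. Map of $n$-tuples: let $f$ be a degree $n$ polynomial correspondence and $\Pi_x,\Pi_y$ the projections of $\Gamma_f$ to $\widehat{\mathbb{C}}_x,\widehat{\mathbb{C}}_y$. For $x_1\in\widehat{\mathbb{C}}_x$, let $y_1(x_1),\dots,y_n(x_1)$ be the points of $\Pi_y(\Pi_x^{-1}\{x_1\}\cap\Gamma_f)$ listed according to intersection multiplicity (equivalently, multiplicity as zeros of the bihomogenised $f(x_1,\cdot)$), and for each $j$ let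 $\{x_1,x_2(y_j(x_1)),\dots,x_n(y_j(x_1))\}$ be the list of points of $\Pi_x(\Pi_y^{-1}\{y_j(x_1)\}\cap\Gamma_f)$, repeated according to multiplicity. For $y_1\in\widehat{\mathbb{C}}_y$, define the points $x_j(y_1)$ and the lists $\{y_1,y_2(x_j(y_1)),\dots,y_n(x_j(y_1))\}$ in the same way with the roles of $x$ and $y$ interchanged. $f$ is a map of $n$-tuples if for each $x_1\in\widehat{\mathbb{C}}_x$ the $n$ lists $\{x_1,x_2(y_j(x_1)),\dots,x_n(y_j(x_1))\}$, $j=1,\dots,n$, coincide, and for each $y_1\in\widehat{\mathbb{C}}_y$ the $n$ lists $\{y_1,y_2(x_j(y_1)),\dots,y_n(x_j(y_1))\}$, $j=1,\dots,n$, coincide (lists being taken with multiplicity, irrespective of order). A fractional degree $d$ function is a rational map of degree $d$ of the Riemann sphere, written as a quotient of two polynomials of degree at most $d$. A factorisation of $f_d=0$ as $\Phi(x)=\Psi(y)$ means that, up to a nonzero constant multiple, $f_d(x,y)$ equals the polynomial obtained by clearing denominators, $\left(\sum_i\kappa_i x^i\right)\left(\sum_j\nu_j y^j\right)-\left(\sum_i\lambda_i x^i\right)\left(\sum_j\mu_j y^j\right)$. The matrix of coefficients of $f_d$ is the $(d+1)\times(d+1)$ matrix whose rows are indexed by $i=d,d-1,\dots,0$, columns by $j=d,d-1,\dots,0$, with entry $A_{(i,j)}$ (the coefficient of $x^iy^j$). ''Up to multiplication by a constant'' means after multiplying the matrix by some nonzero complex constant. *)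

(* Defs.v *)
From mathcomp Require Import all_boot all_order all_algebra polyXY.
From mathcomp Require Import classical_sets cardinality reals complex.
Import Order.TTheory GRing.Theory Num.Theory.

Set Implicit Arguments.
Unset Strict Implicit.
Unset Printing Implicit Defensive.

Local Open Scope classical_set_scope.
Local Open Scope ring_scope.

(* The complex numbers are R[i] for R : realType.  A polynomial f(x, y) is an
   element of {poly {poly R[i]}}, with the conventions of polyXY: 'X is x,
   'X%:P is y, and f`_i`_j is the coefficient A_(i,j) of x^i y^j.             *)

Section Correspondences.
Context {R : realType}.
Local Notation C := R[i].

(* None is the point at infinity. *)
Definition sphere := option C.

Definition conj_sphere (z : sphere) : sphere := omap conjc z.

(* Homogeneous coordinates: Some a is [a : 1], None is [1 : 0]. *)
Definition hcoord (z : sphere) : C * C :=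
  if z is Some a then (a, 1) else (1, 0).

Definition bihom (m n : nat) (f : {poly {poly C}}) (X Y : C * C) : C :=
  \sum_(i < m.+1) \sum_(j < n.+1)
    f`_i`_j * (X.1 ^+ i * X.2 ^+ (m - i)) * (Y.1 ^+ j * Y.2 ^+ (n - j)).

Definition bihom_zeros (m n : nat) (f : {poly {poly C}}) :
    set (sphere * sphere) :=
  [set z | bihom m n f (hcoord z.1) (hcoord z.2) = 0].

Definition Gamma (n : nat) (f : {poly {poly C}}) : set (sphere * sphere) :=
  bihom_zeros n n f.

(* Zariski topology of the product of two projective lines; an element of S is
   a bidegree together with the dehomogenisation of a form of that bidegree.  *)
Definition zariski_closed (Z : set (sphere * sphere)) : Prop :=
  exists S : set (nat * nat * {poly {poly C}}),
    Z = [set z | forall s, S s -> bihom_zeros s.1.1 s.1.2 s.2 z].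

Definition irreducible_subset (Z : set (sphere * sphere)) : Prop :=
  Z !=set0 /\
  forall Z1 Z2, zariski_closed Z1 -> zariski_closed Z2 ->
    Z `<=` Z1 `|` Z2 -> Z `<=` Z1 \/ Z `<=` Z2.

Definition irreducible_component (W Z : set (sphere * sphere)) : Prop :=
  [/\ irreducible_subset Z, Z `<=` W &
      forall Z', irreducible_subset Z' -> Z `<=` Z' -> Z' `<=` W -> Z' = Z].

(* The zeros in C, repeated according to multiplicity; none if q = 0. *)
Definition zeros (q : {poly C}) : seq C :=
  if q == 0 then [::] else sval (closed_field_poly_normal q).

(* The list has n elements over all but finitely many points.  Here
   f.[x%:P] is f(x, .) and (swapXY f).[y%:P] is f(., y).                      *)
Definition generically_n_valued (n : nat) (f : {poly {poly C}}) : Prop :=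
  finite_set [set x : C | size (zeros f.[x%:P]) <> n].

Definition is_correspondence (n : nat) (f : {poly {poly C}}) : Prop :=
  [/\ (1 <= n)%N,
      size f = n.+1 /\ sizeY f = n.+1,
      generically_n_valued n f /\ generically_n_valued n (swapXY f),
      forall a : sphere, ~ irreducible_component (Gamma n f) ([set a] `*` setT)
    & forall a : sphere, ~ irreducible_component (Gamma n f) (setT `*` [set a])].

(* Zeros on the sphere, with multiplicity, of the binary form of degree n
   whose dehomogenisation is q: infinity has multiplicity n - deg q.  This is
   meaningful for q != 0 only, which always holds below for a correspondence. *)
Definition sphere_zeros (n : nat) (q : {poly C}) : seq sphere :=
  map Some (zeros q) ++ nseq (n - (size q).-1) None.

(* The list y_1(x), ..., y_n(x); the polynomial is the dehomogenisation in y
   of the bihomogenised f(x, .).                                              *)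
Definition fibreY (n : nat) (f : {poly {poly C}}) (x : sphere) : seq sphere :=
  let X := hcoord x in
  sphere_zeros n
    (\poly_(j < n.+1) \sum_(i < n.+1) f`_i`_j * (X.1 ^+ i * X.2 ^+ (n - i))).

Definition fibreX (n : nat) (f : {poly {poly C}}) (y : sphere) : seq sphere :=
  fibreY n (swapXY f) y.

Definition is_map_of_tuples (n : nat) (f : {poly {poly C}}) : Prop :=
  [/\ is_correspondence n f,
      forall x y y' : sphere, y \in fibreY n f x -> y' \in fibreY n f x ->
        perm_eq (fibreX n f y) (fibreX n f y')
    & forall y x x' : sphere, x \in fibreX n f y -> x' \in fibreX n f y ->
        perm_eq (fibreY n f x) (fibreY n f x')].

(* Degree of the rational map P / Q, computed in lowest terms. *)
Definition ratmap_degree (P Q : {poly C}) : nat :=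
  (maxn (size (P %/ gcdp P Q)) (size (Q %/ gcdp P Q))).-1.

Definition fractional_degree (d : nat) (P Q : {poly C}) : Prop :=
  [/\ Q != 0, (size P <= d.+1)%N, (size Q <= d.+1)%N & ratmap_degree P Q = d].

(* f = 0 factorises as Phi(x) = Psi(y) with Phi = K / L and Psi = M / N;
   p^:P is p(x) and p%:P is p(y).                                             *)
Definition factorisation (d : nat) (f : {poly {poly C}})
    (K L M N : {poly C}) : Prop :=
  [/\ fractional_degree d K L, fractional_degree d M N
    & exists2 c : C, c != 0 & c%:P%:P * f = K^:P * N%:P - L^:P * M%:P].

Definition coef_matrix (d : nat) (f : {poly {poly C}}) : 'M[C]_d.+1 :=
  \matrix_(i, j) f`_(d - i)`_(d - j).

End Correspondences.

Arguments sphere R : clear implicits.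

(* Main.v *)
Require Import Defs.
From mathcomp Require Import all_boot all_order all_algebra polyXY ring.
From mathcomp Require Import classical_sets cardinality reals complex boolp.
Import Order.TTheory GRing.Theory Num.Theory.
Local Open Scope ring_scope.

Set Implicit Arguments.
Unset Strict Implicit.
Unset Printing Implicit Defensive.

(** Write [f(x, .)] and [f(., y)] for the polynomials obtained by fixing one
    variable.  If the matrix of [f] is real up to a constant, its zero set is
    clearly stable under conjugation, and a factorisation with real coefficients
    displays a real multiple of [f].  So the theorem amounts to two facts about a
    map of tuples that is not a proper power.

    The fibres of [f] are simple for all but finitely many [y]
    ([map_of_tuples_simple]).  The multiplicity of [x] as a root of [f(., y)]
    depends on [x] only, because the lists over two points [y], [y'] of the fibre
    of [x] coincide.  Let [r] be [f] divided by its gcd with its derivative [f_x];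
    the multiplicity is the value of [w / r_x], where [w] is [f_x] divided by the
    same gcd.  Since multiplicities are bounded, [r] and [w - e r_x] have a common
    factor for some constant [e].  That factor meets almost every vertical line,
    hence almost every [x] has multiplicity [e], hence so has every root of
    [f(., y)] for almost every [y].  So [f] is the [e]-th power of a multiple of
    [r], up to a factor depending on [y] only, which the absence of horizontal
    lines makes constant ([map_of_tuples_power]).  An [e]-th root of a map of
    tuples is one ([map_of_tuples_root]), so [e = 1].

    The matrix of [f] has rank two ([rank_two]).  If [x] and [x0] both lie over
    [y], then [f(x, .)] and [f(x0, .)] are proportional, so that
    [f(x, y1) f(x0, y2) = f(x, y2) f(x0, y1)] for all [y1], [y2].  As a polynomial
    in [x], [f(x, y1) f(x0, y2) - f(x, y2) f(x0, y1)] thus vanishes at the [d]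
    distinct roots of [f(., y)], and is a multiple of it.  So [f(., y)] is a
    combination of [f(., y1)] and [f(., y2)] for almost every [y], and solving for
    the coefficients by evaluation at [x1] and [x2] gives an explicit factorisation
    of [f], whose coefficients are real as soon as [f] and the four points are.
    Its two fractions have degree [d], a common zero of numerator and denominator
    being a line on the curve ([fractional_degree_of_factorisation]).

    Finally, if the curve is stable under conjugation, the conjugate of [f(., y)]
    vanishes at the roots of the latter, which are simple, so [f] and its conjugate
    are proportional and a multiple of [f] is real ([real_up_to_constant]). *)

(** * Multiplicities of roots *)

Section FieldMultiplicities.
Variable F : numFieldType.
Implicit Types (p q s w : {poly F}) (x : F).

Lemma mup_gt0 p x : p != 0 -> (0 < mup x p)%N = root p x.
Proof. by move=> p0; rewrite -XsubC_dvd // dvdp_XsubCl. Qed.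

Lemma mupX p x e : p != 0 -> mup x (p ^+ e) = (e * mup x p)%N.
Proof.
move=> p0; elim: e => [|e IHe].
  by rewrite expr0 mupNroot // rootC oner_eq0.
by rewrite exprS mupM ?expf_neq0 // IHe mulSn.
Qed.

Lemma mup_simple p x : root p x -> p^`().[x] != 0 -> mup x p = 1%N.
Proof.
move=> px p'x; have p0 : p != 0.
  by apply: contraNneq p'x => ->; rewrite derivC horner0.
apply/eqP; rewrite eqn_leq mup_leq // -XsubC_dvd // dvdp_XsubCl px andbT.
apply: contra p'x => /Pdiv.Field.dvdpP[q ->].
rewrite expr2 mulrA derivM derivXsubC mulr1 hornerD !hornerM hornerXsubC.
by rewrite subrr !mulr0 addr0.
Qed.

(** Typically [q] and [w] are [p] and its derivative divided by their gcd, so that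
    [w / q] is the logarithmic derivative of [p]: it has simple poles, and the
    residue at a root of [p] is the multiplicity of that root. *)
Lemma logarithmic_derivative p q w x : p != 0 -> root p x ->
  p^`() * q = p * w -> ~~ (root q x && root w x) ->
  [/\ root q x, q^`().[x] != 0 & w.[x] = (mup x p)%:R * q^`().[x]].
Proof.
move=> p0 px pqw cop; have [m [s]] := multiplicity_XsubC p x.
rewrite p0 /= => sx pE.
have s0 : s != 0 by apply: contraNneq sx => ->; rewrite root0.
have t0 : 'X - x%:P != 0 by rewrite polyXsubC_eq0.
have mE : mup x p = m.
  by rewrite pE mupMr // mup_XsubCX eqxx.
(* The factor (X - x)^(m - 1) common to both sides is cancelled, and the rest is
   evaluated at x: this gives first q(x) = 0, then, cancelling another X - x,
   the value of w(x). *)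
case: m => [|m] in pE mE.
  by move: px; rewrite pE expr0 mulr1 (negPf sx).
have eq1 : (s^`() * ('X - x%:P) + s *+ m.+1) * q = s * ('X - x%:P) * w.
  apply: (mulfI (expf_neq0 m t0)); rewrite mulrA.
  have -> : ('X - x%:P) ^+ m * (s^`() * ('X - x%:P) + s *+ m.+1) = p^`().
    rewrite pE derivM deriv_exp derivXsubC mul1r /= exprS.
    rewrite mulrDr !mulrnAr mulrCA [_ ^+ m * ('X - _)]mulrC.
    by rewrite [_ ^+ m * s]mulrC.
  by rewrite pqw pE exprS -!mulrA [RHS]mulrCA; congr (_ * _); apply: mulrCA.
have qx : root q x.
  have /eqP := congr1 (horner^~ x) eq1.
  rewrite /= !(hornerXsubC, hornerM, hornerD, hornerMn) subrr.
  rewrite !(mulr0, mul0r, add0r) mulf_eq0.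
  by rewrite mulrn_eq0 /= -[_ == 0]/(root s x) (negPf sx).
have /factor_theorem[q1 q1E] := qx.
have q'x : q^`().[x] = q1.[x].
  rewrite q1E derivM derivXsubC hornerD !hornerM hornerXsubC hornerC.
  by rewrite subrr mulr0 add0r mulr1.
have wx : w.[x] = m.+1%:R * q1.[x].
  have eq2 : (s^`() * ('X - x%:P) + s *+ m.+1) * q1 = s * w.
    apply: (mulIf t0); rewrite -mulrA -q1E eq1 -!mulrA; congr (_ * _).
    exact: mulrC.
  have := congr1 (horner^~ x) eq2.
  rewrite /= !(hornerXsubC, hornerM, hornerD, hornerMn) subrr mulr0 add0r.
  by rewrite mulrnAl -mulrnAr => /(mulfI sx) <-; rewrite mulr_natl.
split; rewrite ?mE ?q'x //; apply: contraNneq cop => q1x.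
by rewrite qx /root wx q1x mulr0 eqxx.
Qed.

End FieldMultiplicities.

Lemma exprn_coef_top (S : idomainType) (p : {poly S}) n e :
  (size p <= n.+1)%N -> (p ^+ e)`_(e * n) = p`_n ^+ e.
Proof.
move=> sp; elim: e => [|e IHe]; first by rewrite mul0n !expr0 coef1.
have le_sX : (size (p ^+ e) <= (e * n).+1)%N.
  have [->|p0] := eqVneq p 0.
    by rewrite expr0n; case: (e == 0%N); rewrite ?size_poly1 ?size_poly0.
  rewrite -(ltn_predK (_ : 0 < size (p ^+ e))%N) ?size_poly_gt0 ?expf_neq0 //.
  rewrite size_exp ltnS mulnC leq_mul2l; apply/orP; right.
  by rewrite -ltnS (ltn_predK (_ : 0 < size p)%N) ?size_poly_gt0.
rewrite exprS mulSn coefM exprS -IHe.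
have lt_n : (n < (n + e * n).+1)%N by rewrite ltnS leq_addr.
rewrite (bigD1 (Ordinal lt_n)) //= addKn big1 ?addr0 // => i.
rewrite -val_eqE /= neq_ltn => /orP[lt_in|lt_ni].
  rewrite [X in _ * X]nth_default ?mulr0 //; apply: leq_trans le_sX _.
  by rewrite -addnBAC ?(ltnW lt_in) // -addn1 addnC leq_add2r subn_gt0.
by rewrite [X in X * _]nth_default ?mul0r //; apply: leq_trans sp _.
Qed.

Lemma size_pow_root (S : idomainType) (p : {poly S}) e n : (0 < e)%N ->
  size (p ^+ e) = (e * n).+1 -> size p = n.+1.
Proof.
move=> e0 sp; have p0 : p != 0.
  by apply: contraPneq sp => ->; rewrite expr0n eqn0Ngt e0 size_poly0.
have sp0 : (0 < size p)%N by rewrite size_poly_gt0.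
have := congr1 predn sp; rewrite size_exp mulnC /= => /eqP.
by rewrite eqn_pmul2l // => /eqP <-; rewrite prednK.
Qed.

(** * Zeros of binary forms on the sphere *)

Section Zeros.
Context {R : realType}.
Local Notation C := R[i].
Implicit Types (p q : {poly C}) (a b x : C) (z : sphere R).

Lemma zeros_prod q :
  q = lead_coef q *: \prod_(z <- zeros q) ('X - z%:P).
Proof.
rewrite /zeros; case: eqP => [->|_]; first by rewrite lead_coef0 scale0r.
by case: closed_field_poly_normal.
Qed.

Lemma count_zeros q a : q != 0 -> count_mem a (zeros q) = mup a q.
Proof.
move=> q0; rewrite {2}(zeros_prod q) -mul_polyC mupMr ?mu_prod_XsubC //.
by rewrite rootC lead_coef_eq0.
Qed.

Lemma mem_zeros q a : q != 0 -> (a \in zeros q) = root q a.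
Proof.
move=> q0; rewrite {2}(zeros_prod q) rootZ ?lead_coef_eq0 //.
by rewrite root_prod_XsubC.
Qed.

Lemma size_zeros q : size (zeros q) = (size q).-1.
Proof.
have [->|q0] := eqVneq q 0; first by rewrite /zeros eqxx size_poly0.
rewrite {2}(zeros_prod q) size_scale ?lead_coef_eq0 //.
by rewrite size_prod_XsubC.
Qed.

Lemma perm_zeros p q : perm_eq (zeros p) (zeros q) ->
  lead_coef q *: p = lead_coef p *: q.
Proof.
move=> pq; rewrite {1}(zeros_prod p) [q in RHS]zeros_prod !scalerA mulrC.
by rewrite (perm_big _ pq).
Qed.

Lemma mup_lt_size p x : p != 0 -> (mup x p < size p)%N.
Proof.
move=> p0; rewrite -count_zeros // (leq_ltn_trans (count_size _ _)) //.
by rewrite size_zeros ltn_predL size_poly_gt0.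
Qed.

Lemma pow_of_mup p q e :
  p != 0 -> q != 0 -> (forall x, mup x p = (e * mup x q)%N) ->
  lead_coef q ^+ e *: p = lead_coef p *: q ^+ e.
Proof.
move=> p0 q0 mupE; rewrite -lead_coef_exp; apply: perm_zeros.
by apply/allP => x _ /=; rewrite !count_zeros ?expf_neq0 // mupX // mupE.
Qed.

(** The combination of [p] and [q] that cancels the top coefficient has more roots
    than its degree allows. *)
Lemma simple_zeros_proportional p q : p != 0 -> uniq (zeros p) ->
  (size q <= size p)%N -> (forall x, root p x -> root q x) ->
  lead_coef p *: q = q`_(size p).-1 *: p.
Proof.
move=> p0 up sq rpq; apply/eqP; rewrite -subr_eq0; apply/eqP.
apply: (roots_geq_poly_eq0 (rs := zeros p)) => //.
  apply/allP => x; rewrite mem_zeros // => px.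
  rewrite /root hornerD hornerN !hornerZ (eqP px) (eqP (rpq x px)).
  by rewrite !mulr0 subrr.
rewrite size_zeros; apply/leq_sizeP => j; rewrite leq_eqVlt coefB !coefZ.
case/orP => [/eqP <-|lt_j]; first by rewrite mulrC subrr.
have sp : (size p <= j)%N.
  by rewrite -(ltn_predK (_ : 0 < size p)%N) ?size_poly_gt0.
have sqj : (size q <= j)%N := leq_trans sq sp.
by rewrite [q`_j]nth_default // [p`_j]nth_default // !mulr0 subrr.
Qed.

Lemma horner_nat_neq0 (p : {poly C}) : p != 0 -> exists n : nat, p.[n%:R] != 0.
Proof.
move=> p0; pose s := [seq (n%:R : C) | n <- iota 0 (size p)].
have us : uniq s.
  by rewrite map_inj_uniq ?iota_uniq // => m n /eqP; rewrite eqr_nat => /eqP.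
have : ~~ all (root p) s.
  apply/negP => rs; have := max_poly_roots p0 rs us.
  by rewrite size_map size_iota ltnn.
by case/allPn => _ /mapP[n _ ->] pn; exists n.
Qed.

(** The value at [z] of the form of degree [n] whose dehomogenisation is [q]. *)
Definition form_at (n : nat) q z : C := if z is Some b then q.[b] else q`_n.

Lemma form_at_neq0 n (p : {poly C}) y : form_at n p y != 0 -> p != 0.
Proof.
by apply: contraNneq => ->; case: y => [b|] /=; rewrite ?horner0 ?coef0.
Qed.

Lemma form_atX e n (q : {poly C}) y : (size q <= n.+1)%N ->
  form_at (e * n) (q ^+ e) y = form_at n q y ^+ e.
Proof.
by case: y => [b|] /= sq; rewrite ?horner_exp // exprn_coef_top.
Qed.

Lemma count_sphere_zeros_Some n q a :
  count_mem (Some a) (sphere_zeros n q) = count_mem a (zeros q).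
Proof.
rewrite count_cat count_map count_nseq mul0n addn0.
by apply: eq_count => b /=; rewrite (inj_eq Some_inj).
Qed.

Lemma count_sphere_zeros_None n q :
  count_mem None (sphere_zeros n q) = (n - (size q).-1)%N.
Proof.
rewrite count_cat count_map count_nseq mul1n.
by rewrite (@eq_count _ _ pred0) ?count_pred0.
Qed.

Lemma mem_sphere_zeros n q z : q != 0 -> (size q <= n.+1)%N ->
  (z \in sphere_zeros n q) = (form_at n q z == 0).
Proof.
move=> q0 sq; rewrite -has_pred1 has_count.
case: z => [b|].
  by rewrite count_sphere_zeros_Some -has_count has_pred1 mem_zeros.
rewrite count_sphere_zeros_None subn_gt0 /=.
have sq0 : (0 < size q)%N by rewrite size_poly_gt0.
rewrite -(ltn_predK sq0) ltnS in sq.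
apply/idP/eqP => [lt_n|qn]; first by rewrite nth_default // -(ltn_predK sq0).
rewrite ltn_neqAle sq andbT; apply: contra_eq_neq qn => <-.
by rewrite -[_`__]/(lead_coef q) lead_coef_eq0.
Qed.

Lemma perm_sphere_zeros n p q :
  perm_eq (sphere_zeros n p) (sphere_zeros n q) ->
  lead_coef q *: p = lead_coef p *: q.
Proof.
move=> pq; apply: perm_zeros; apply/allP => a _.
by rewrite /= -!(count_sphere_zeros_Some n); move/permP: pq => ->.
Qed.

Lemma sphere_zerosX e n q z : (0 < n)%N -> (size q <= n.+1)%N ->
  count_mem z (sphere_zeros (e * n) (q ^+ e)) =
  (e * count_mem z (sphere_zeros n q))%N.
Proof.
move=> n0 sq; have [->|q0] := eqVneq q 0.
  rewrite /sphere_zeros; case: e => [|e].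
    have z1 : zeros (1 : {poly C}) = [::].
      by apply: size0nil; rewrite size_zeros size_poly1.
    by rewrite expr0 !mul0n z1 size_poly1.
  by rewrite expr0n /= size_poly0 /zeros eqxx /= !subn0 !count_nseq mulnCA.
case: z => [a|].
  rewrite !count_sphere_zeros_Some !count_zeros ?expf_neq0 //.
  exact: mupX.
rewrite !count_sphere_zeros_None size_exp mulnC [RHS]mulnBr.
by rewrite [((size q).-1 * e)%N]mulnC [(n * e)%N]mulnC.
Qed.

End Zeros.

(** * Slices of a form by a value of the first variable *)

Section Slices.
Context {R : realType}.
Local Notation C := R[i].
Implicit Types (f g : {poly {poly C}}) (a b : C) (x y z : sphere R).

(** The slice at [x] of a form of arbitrary bidegree, read off the coefficients that
    the bidegree retains. *)
Definition hslice (m n : nat) f x : {poly C} :=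
  let X := hcoord x in
  \poly_(j < n.+1) \sum_(i < m.+1) f`_i`_j * (X.1 ^+ i * X.2 ^+ (m - i)).

Lemma bihom_form_at m n f x y :
  bihom m n f (hcoord x) (hcoord y) = form_at n (hslice m n f x) y.
Proof.
rewrite /bihom exchange_big /=; case: y => [b|] /=.
  rewrite horner_poly; apply: eq_bigr => j _.
  by rewrite mulr_suml; apply: eq_bigr => i _; rewrite expr1n mulr1.
rewrite coef_poly ltnSn big_ord_recr /= big1 ?add0r => [|j _].
  by apply: eq_bigr => i _; rewrite subnn expr1n !mulr1.
apply: big1 => i _; rewrite [0 ^+ _]expr0n subn_eq0 leqNgt ltn_ord /=.
by rewrite !mulr0.
Qed.

Lemma bihom_zerosE m n f x y :
  bihom_zeros m n f (x, y) = (form_at n (hslice m n f x) y = 0).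
Proof. by rewrite -bihom_form_at. Qed.

(** The same slice when [f] has no coefficient outside the bidegree: the value at
    infinity is then the top coefficient. *)
Definition slice (n : nat) f x : {poly C} :=
  if x is Some a then f.[a%:P] else f`_n.

Lemma hslice_slice m n f x : (size f <= m.+1)%N -> (sizeY f <= n.+1)%N ->
  hslice m n f x = slice m f x.
Proof.
move=> sf sYf; apply/polyP => j; rewrite coef_poly.
case: ltnP => [_|le_nj]; last first.
  case: x => [a|] /=; rewrite nth_default //.
    exact: leq_trans (max_size_evalC _ _) (leq_trans sYf le_nj).
  exact: leq_trans (max_size_coefXY _ _) (leq_trans sYf le_nj).
case: x => [a|] /=.
  rewrite (horner_coef_wide _ sf) coef_sum; apply: eq_bigr => i _.
  by rewrite expr1n mulr1 -polyC_exp coefMC.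
rewrite big_ord_recr /= big1 ?add0r => [|i _].
  by rewrite subnn expr1n !mulr1.
by rewrite expr0n subn_eq0 leqNgt ltn_ord /= !mulr0.
Qed.

Lemma size_slice n f x : (sizeY f <= n.+1)%N -> (size (slice n f x) <= n.+1)%N.
Proof.
move=> sYf; case: x => [a|] /=.
  exact: leq_trans (max_size_evalC _ _) sYf.
exact: leq_trans (max_size_coefXY _ _) sYf.
Qed.

Lemma sliceX e n g x : (size g <= n.+1)%N ->
  slice (e * n) (g ^+ e) x = slice n g x ^+ e.
Proof.
by case: x => [a|] /= sg; rewrite ?horner_exp // exprn_coef_top.
Qed.

Lemma fibreYE n f x : (size f <= n.+1)%N -> (sizeY f <= n.+1)%N ->
  fibreY n f x = sphere_zeros n (slice n f x).
Proof. by move=> sf sYf; rewrite -(@hslice_slice n n). Qed.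

Lemma fibreYX e n g (x z : sphere R) :
  (0 < n)%N -> (size g <= n.+1)%N -> (sizeY g <= n.+1)%N ->
  size (g ^+ e) = (e * n).+1 -> sizeY (g ^+ e) = (e * n).+1 ->
  count_mem z (fibreY (e * n) (g ^+ e) x) = (e * count_mem z (fibreY n g x))%N.
Proof.
move=> n0 sg sYg sf sYf; rewrite !fibreYE ?sf ?sYf // sliceX //.
by rewrite sphere_zerosX // size_slice.
Qed.

Lemma GammaE n f x y : (size f <= n.+1)%N -> (sizeY f <= n.+1)%N ->
  Gamma n f (x, y) <-> form_at n (slice n f x) y = 0.
Proof. by move=> sf sYf; rewrite /Gamma bihom_zerosE hslice_slice. Qed.

End Slices.

(** * The curve of a correspondence contains no line *)

Section NoLine.
Context {R : realType}.
Local Notation C := R[i].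
Implicit Types (f g : {poly {poly C}}) (a b : C) (x y : sphere R).
Implicit Types Z : set (sphere R * sphere R).
Local Open Scope classical_set_scope.

(** On the line, two forms are binary forms in [y]; if neither vanishes identically,
    their product does not, so the line is not covered by their zeros. *)
Lemma vertical_irreducible x :
  irreducible_subset ([set x] `*` setT : set (sphere R * sphere R)).
Proof.
split; first by exists (x, None).
move=> _ _ [S1 ->] [S2 ->] cover; apply: contrapT => /not_orP[].
move=> /existsNP[[x1 y1]] /not_implyP[[/= -> _]].
move=> /existsNP[s1] /not_implyP[S1s1].
rewrite bihom_zerosE => /eqP/form_at_neq0 p1.
move=> /existsNP[[x2 y2]] /not_implyP[[/= -> _]].
move=> /existsNP[s2] /not_implyP[S2s2].
rewrite bihom_zerosE => /eqP/form_at_neq0 p2.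
have /horner_nat_neq0[n] := mulf_neq0 p1 p2.
rewrite hornerM mulf_eq0 => /norP[n1 n2].
have [Zn|Zn] := cover (x, Some n%:R) (conj erefl I).
  by have := Zn _ S1s1; rewrite bihom_zerosE => /eqP; apply/negP.
by have := Zn _ S2s2; rewrite bihom_zerosE => /eqP; apply/negP.
Qed.

Lemma bihom_zeros_closed m n f : zariski_closed (bihom_zeros m n f).
Proof.
exists [set ((m, n), f)]; apply/seteqP; split => z /=; first by move=> z0 _ ->.
by move=> /(_ (m, n, f) erefl).
Qed.

(** If [f(a, .)] vanishes, write [f = (x - a)^k g] with [g(a, .)] nonzero: the
    curve is covered by the vertical line at [a] and a closed set not containing
    that line, so an irreducible set between the line and the curve is the line. *)
Lemma no_vertical_line n f a : is_correspondence n f -> f.[a%:P] != 0.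
Proof.
move=> [_ [sf sYf] _ noV _]; apply/eqP => fa.
have f0 : f != 0 by rewrite -size_poly_gt0 sf.
have [k [g ga fE]] := multiplicity_XsubC f a%:P.
rewrite f0 /= in ga.
have k0 : (0 < k)%N.
  case: k fE => // fE; move: ga; rewrite -[g]mulr1 -(expr0 ('X - a%:P%:P)) -fE.
  by rewrite /root fa eqxx.
have g0 : g != 0 by apply: contraNneq ga => ->; rewrite root0.
have sg : (size g <= n)%N.
  have : size f = (size g + k)%N.
    by rewrite fE size_mul ?expf_neq0 ?polyXsubC_eq0 // size_exp_XsubC addnS.
  by rewrite sf => nE; rewrite -ltnS nE -addn1 leq_add2l.
have sYg : (sizeY g <= n.+1)%N.
  rewrite sizeYE; rewrite sizeYE fE rmorphM in sYf.
  rewrite size_mul ?swapXY_eq0 ?expf_neq0 ?polyXsubC_eq0 // in sYf.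
  rewrite -sYf -ltnS prednK.
    rewrite -addn1 leq_add2l size_poly_gt0 swapXY_eq0.
    by rewrite expf_neq0 ?polyXsubC_eq0.
  by rewrite addn_gt0 size_poly_gt0 swapXY_eq0 g0.
apply: (noV (Some a)); split; first exact: vertical_irreducible.
  move=> [x y] [/= -> _]; apply/GammaE; rewrite ?sf ?sYf //=.
  by rewrite fa; case: y => [b|] /=; rewrite ?horner0 ?coef0.
move=> Z [Z0 irrZ] lineZ ZG; apply/seteqP; split => //.
have line_closed :
    zariski_closed ([set Some a] `*` setT : set (sphere R * sphere R)).
  suff -> : [set Some a] `*` setT =
      bihom_zeros 1 0 ('X - a%:P%:P : {poly {poly C}})%R.
    exact: bihom_zeros_closed.
  have sX : (size ('X - a%:P%:P : {poly {poly C}})%R <= 2)%N.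
    by rewrite size_XsubC.
  have sYX : (sizeY ('X - a%:P%:P : {poly {poly C}})%R <= 1)%N.
    apply/bigmax_leqP => i _; rewrite coefB coefX coefC.
    case: (nat_of_ord i) => [|[|j]] /=.
    - by rewrite sub0r size_polyN size_polyC_leq1.
    - by rewrite subr0 size_poly1.
    by rewrite subr0 size_poly0.
  apply/seteqP; split => -[x y]; rewrite bihom_zerosE hslice_slice //.
    by move=> [/= -> _]; rewrite /= hornerXsubC subrr; case: y => [b|];
      rewrite /= ?horner0 ?coef0.
  case: x => [c|] /=.
    rewrite hornerXsubC -polyCB => ca; split=> //=.
    suff /eqP : c - a = 0 by rewrite subr_eq0 => /eqP ->.
    by move: ca; case: y => [b|] /=; rewrite ?hornerC ?coefC.
  rewrite coefB coefX coefC subr0.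
  by case: y => [b|] /=; rewrite ?hornerC ?coefC => /eqP; rewrite oner_eq0.
(* As a form of bidegree (n, n), g also vanishes on the line x = oo, so that its
   zeros contain the points of the curve with x = oo. *)
have [||||ZZ2] // := irrZ ([set Some a] `*` setT) (bihom_zeros n n g).
- exact: bihom_zeros_closed.
- move=> [x y] /ZG/GammaE; rewrite sf sYf => /(_ (leqnn _) (leqnn _)).
  suff aux : form_at n (slice n f x) y = 0 ->
      x = Some a \/ form_at n (slice n g x) y = 0.
    move=> /aux[->|gxy]; [by left | right].
    by rewrite bihom_zerosE hslice_slice // leqW.
  case: x => [c|] /=; last first.
    by right; rewrite [g`_n]nth_default //; case: (y) => [b|] /=;
      rewrite ?horner0 ?coef0.
  rewrite fE hornerM horner_exp hornerXsubC -polyCB -polyC_exp mulrC mul_polyC.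
  have -> : form_at n ((c - a) ^+ k *: g.[c%:P]) y =
            (c - a) ^+ k * form_at n g.[c%:P] y.
    by case: (y) => [b|] /=; rewrite ?hornerZ ?coefZ.
  move=> /eqP; rewrite mulf_eq0 expf_eq0 k0 /= subr_eq0 => /orP[|] /eqP.
    by move=> ->; left.
  by right.
have [m] := horner_nat_neq0 ga.
have /ZZ2 : Z (Some a, Some m%:R) by apply: lineZ.
rewrite bihom_zerosE hslice_slice //; last exact: leqW.
by move=> /= ->; rewrite eqxx.
Qed.

(** Exchanging the two variables carries vertical lines to horizontal ones. *)
Definition transpose_set Z : set (sphere R * sphere R) :=
  [set z | Z (z.2, z.1)].

Lemma transpose_setK : involutive transpose_set.
Proof. by move=> Z; apply/seteqP; split=> -[x y]. Qed.

Lemma bihom_zeros_swap m n f :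
  bihom_zeros n m (swapXY f) = transpose_set (bihom_zeros m n f).
Proof.
rewrite /transpose_set /bihom_zeros /bihom.
apply/seteqP; split=> -[y x] /= z0.
  rewrite exchange_big -[RHS]z0; apply: eq_bigr => j _; apply: eq_bigr => i _.
  by rewrite coef_swapXY mulrAC.
rewrite exchange_big -[RHS]z0; apply: eq_bigr => j _; apply: eq_bigr => i _.
by rewrite coef_swapXY mulrAC.
Qed.

Lemma zariski_closed_transpose Z :
  zariski_closed Z -> zariski_closed (transpose_set Z).
Proof.
move=> [S ->]; exists [set s | S ((s.1.2, s.1.1), swapXY s.2)].
apply/seteqP; split=> -[x y] Zz [[m n] f] Ss.
  by have := Zz _ Ss; rewrite /= bihom_zeros_swap.
have Ss' : S ((m, n), swapXY (swapXY f)) by rewrite swapXYK.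
by have := Zz ((n, m), swapXY f) Ss'; rewrite /= bihom_zeros_swap.
Qed.

Lemma irreducible_transpose Z :
  irreducible_subset Z -> irreducible_subset (transpose_set Z).
Proof.
move=> [[[x y] Zxy] irrZ]; split; first by exists (y, x).
move=> Z1 Z2 /zariski_closed_transpose c1 /zariski_closed_transpose c2 cover.
have [[x' y'] Zz||] := irrZ _ _ c1 c2.
- exact: (cover (y', x')).
- by move=> sub; left => -[x' y'] /sub.
by move=> sub; right => -[x' y'] /sub.
Qed.

Lemma component_transpose W Z : irreducible_component W Z ->
  irreducible_component (transpose_set W) (transpose_set Z).
Proof.
move=> [irrZ ZW maxZ]; split; first exact: irreducible_transpose.
  by move=> [x y] /ZW.
move=> Z' /irreducible_transpose irrZ' ZZ' Z'W.
rewrite -(transpose_setK Z'); congr transpose_set; apply: maxZ => //.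
  by move=> [x y] Zxy; apply: (ZZ' (y, x)).
by move=> [x y] /Z'W.
Qed.

Lemma correspondence_swap n f :
  is_correspondence n f -> is_correspondence n (swapXY f).
Proof.
move=> [n1 [sf sYf] [gf gf'] noV noH]; split=> //.
- by rewrite sizeYE swapXYK -sizeYE.
- by rewrite swapXYK.
- move=> a /component_transpose.
  rewrite /Gamma bihom_zeros_swap transpose_setK => comp; apply: (noH a).
  by move: comp; congr irreducible_component; apply/seteqP; split=> -[x y] [].
move=> a /component_transpose.
rewrite /Gamma bihom_zeros_swap transpose_setK => comp; apply: (noV a).
by move: comp; congr irreducible_component; apply/seteqP; split=> -[x y] [].
Qed.

Lemma no_horizontal_line n f b :
  is_correspondence n f -> (swapXY f).[b%:P] != 0.
Proof. by move=> /correspondence_swap; apply: no_vertical_line. Qed.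

End NoLine.

(** * Properties of almost all values of a variable *)

Section Generic.
Context {R : realType}.
Local Notation C := R[i].
Implicit Types (f g h r w : {poly {poly C}}) (p c : {poly C}) (a b x y : C).

Local Notation at_y y := (map_poly (horner_eval y)).

(** [P] holds off a finite set, given as the zeros of a polynomial: conjunctions are
    then products, and the leading coefficients and Bezout constants that arise are
    witnesses as they stand. *)
Definition generic (P : C -> Prop) : Prop :=
  exists2 c : {poly C}, c != 0 & forall y, c.[y] != 0 -> P y.

Lemma genericW (P Q : C -> Prop) :
  (forall y, P y -> Q y) -> generic P -> generic Q.
Proof. by move=> PQ [c c0 cP]; exists c => // y /cP/PQ. Qed.

Lemma genericI (P Q : C -> Prop) :
  generic P -> generic Q -> generic (fun y => P y /\ Q y).
Proof.
move=> [c c0 cP] [d d0 dQ]; exists (c * d); first by rewrite mulf_neq0.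
by move=> y; rewrite hornerM mulf_eq0 => /norP[/cP ? /dQ ?].
Qed.

Lemma generic_exists (P : C -> Prop) : generic P -> exists y, P y.
Proof. by move=> [c /horner_nat_neq0[m cm] cP]; exists m%:R; apply: cP. Qed.

Lemma generic_neq0 p : p != 0 -> generic (fun y => p.[y] != 0).
Proof. by exists p. Qed.

Lemma generic_eq0 p : generic (fun y => p.[y] = 0) -> p = 0.
Proof.
move=> pz; apply/eqP; apply: contraT => /generic_neq0/(genericI pz).
by move=> /generic_exists[y [-> /eqP]].
Qed.

Lemma generic_all (I : eqType) (s : seq I) (P : I -> C -> Prop) :
  (forall i, i \in s -> generic (P i)) ->
  generic (fun y => forall i, i \in s -> P i y).
Proof.
elim: s => [|i s IHs] Ps; first by exists 1; rewrite ?oner_neq0.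
have Pi : generic (P i) by apply: Ps; rewrite mem_head.
have := genericI Pi (IHs _); case=> [j js|c c0 cP].
  by apply: Ps; rewrite inE js orbT.
exists c => // y /cP[Piy Psy] j; rewrite inE => /orP[/eqP -> //|]; exact: Psy.
Qed.

Lemma generic_finite (P : C -> Prop) : generic P -> finite_set [set x | ~ P x].
Proof.
move=> [c c0 cP]; apply: (sub_finite_set _ (finite_seq (zeros c))) => x nPx /=.
rewrite mem_zeros //; apply: contra_notT nPx; exact: cP.
Qed.

Lemma swapXY_at_y f y : (swapXY f).[y%:P] = at_y y f.
Proof. exact: horner_swapXY. Qed.

Lemma horner_at_y f x y : (at_y y f).[x] = f.[x%:P].[y].
Proof. by rewrite -swapXY_at_y horner2_swapXY. Qed.

Lemma at_yZ y c f : at_y y (c *: f) = c.[y] *: at_y y f.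
Proof. exact: map_polyZ. Qed.

Lemma generic_at_y_eq0 f : generic (fun y => at_y y f = 0) -> f = 0.
Proof.
move=> f0; apply/polyP => i; rewrite coef0; apply: generic_eq0.
apply: genericW f0 => y /(congr1 (fun p : {poly C} => p`_i)).
by rewrite coef_map coef0.
Qed.

Lemma generic_lead_coef f :
  generic (fun y => size (at_y y f) = size f /\
                    lead_coef (at_y y f) = (lead_coef f).[y]).
Proof.
have [->|f0] := eqVneq f 0.
  exists 1; first exact: oner_neq0.
  by move=> y _; rewrite map_poly0 !size_poly0 !lead_coef0 horner0.
exists (lead_coef f); first by rewrite lead_coef_eq0.
by move=> y fy; rewrite size_map_poly_id0 // lead_coef_map_id0 // [LHS]horner0.
Qed.

Lemma generically_valued n f : sizeY f = n.+1 -> generically_n_valued n f.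
Proof.
move=> sYf; apply: generic_finite.
apply: genericW (generic_lead_coef (swapXY f)) => x [sx _].
by rewrite size_zeros -[f]swapXYK swapXY_at_y sx -sizeYE sYf.
Qed.

Lemma coprime_generic r w : coprimep r w ->
  generic (fun y => forall x, ~~ (root (at_y y r) x && root (at_y y w) x)).
Proof.
move=> /Pdiv.Idomain.Bezout_coprimepP[[u v]] /=.
move=> /Pdiv.Idomain.eqpP[[c1 c2] /= c12 uvE].
have /andP[c10 c20] := c12.
exists c2 => // y c2y x; apply/negP => /andP[/eqP rx /eqP wx].
have /(congr1 (horner^~ x)) := congr1 (at_y y) uvE.
rewrite /= !at_yZ rmorphD !rmorphM rmorph1 /= !hornerZ hornerD !hornerM.
rewrite rx wx hornerC !(mulr0, addr0, mulr1).
by move/esym/eqP; apply/negP.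
Qed.

Lemma generic_dvd c f g h : c != 0 -> c *: f = g * h ->
  generic (fun y => forall x, root (at_y y h) x -> root (at_y y f) x).
Proof.
move=> c0 fE; exists c => // y cy x /eqP hx.
have /(congr1 (horner^~ x))/eqP := congr1 (at_y y) fE.
rewrite /= at_yZ rmorphM /= hornerZ hornerM hx mulr0 mulf_eq0.
by rewrite (negPf cy).
Qed.

(** * Polynomials without factors depending on y only *)

Definition primitive f : Prop := forall b, at_y b f != 0.

Lemma primitive_part h : h != 0 ->
  exists c h0, [/\ c != 0, h = c *: h0 & primitive h0].
Proof.
have [n] := ubnP (sizeY h); elim: n h => // n IHn h sh h0.
have [prim_h|] := pselect (primitive h).
  by exists 1, h; rewrite oner_neq0 scale1r.
move=> /existsNP[b /negP/negPn]; rewrite -swapXY_at_y.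
rewrite -[_ == 0]/(root _ _) => /factor_theorem[q qE].
have hE : h = ('X - b%:P) *: swapXY q.
  rewrite -mul_polyC -(swapXYK h) qE rmorphM rmorphB /= swapXY_X swapXY_polyC.
  by rewrite map_polyC mulrC polyCB.
have q0 : swapXY q != 0.
  by apply: contraNneq h0; rewrite hE => ->; rewrite scaler0.
have [||c [h1 [c0 h1E prim_h1]]] := IHn (swapXY q) => //.
  rewrite -ltnS; apply: leq_trans sh; rewrite ltnS !sizeYE swapXYK qE.
  rewrite swapXY_eq0 in q0.
  by rewrite size_mul ?polyXsubC_eq0 // size_XsubC addn2.
exists (('X - b%:P) * c), h1; split=> //; last by rewrite hE h1E scalerA.
by rewrite mulf_neq0 ?polyXsubC_eq0.
Qed.

(** Gauss lemma over [C]: constants in [y] are products of factors [y - b], each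
    of which divides no primitive polynomial. *)
Lemma primitive_proportional f g c0 c1 :
  primitive f -> primitive g -> c0 != 0 -> c0 *: f = c1 *: g ->
  exists2 k : C, k != 0 & f = k%:P *: g.
Proof.
move=> pf pg; have [n] := ubnP (size c0).
elim: n c0 c1 => // n IHn c0 c1 sc c00 fg.
have root_c1 b : root c0 b -> root c1 b.
  move=> /eqP c0b; have /eqP := congr1 (at_y b) fg.
  by rewrite !at_yZ c0b scale0r eq_sym scaler_eq0 (negPf (pg b)) orbF.
have [sc0|/closed_rootP[b c0b]] := eqVneq (size c0) 1%N; last first.
  have /factor_theorem[d1 d1E] := root_c1 b c0b.
  have /factor_theorem[d0 d0E] := c0b.
  have d00 : d0 != 0 by apply: contraNneq c00; rewrite d0E => ->; rewrite mul0r.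
  apply: (IHn d0 d1) => //.
    by move: sc; rewrite d0E size_mul ?polyXsubC_eq0 // size_XsubC addn2.
  have XC0 : ('X - b%:P)%:P != 0 :> {poly {poly C}}.
    by rewrite polyC_eq0 polyXsubC_eq0.
  apply: (mulfI XC0); rewrite !mul_polyC !scalerA.
  by rewrite ![('X - _) * _]mulrC -d0E -d1E.
have /size_poly1P[c cn0 c0E] := introT eqP sc0.
have fE : f = (c^-1%:P * c1) *: g.
  by rewrite -scalerA -fg c0E scalerA -polyCM mulVf // scale1r.
have [/eqP|/closed_rootP[b rb]] := eqVneq (size (c^-1%:P * c1)) 1%N.
  by move=> /size_poly1P[k k0 kE]; exists k; rewrite // fE kE.
by have := pf b; rewrite fE at_yZ (eqP rb) scale0r eqxx.
Qed.

(** A primitive factor [h] of a curve without vertical lines depends on [y], so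
    [h(x, .)] has a root for almost all [x]; it is one of the finitely many excluded
    values of [y] for finitely many [x] only, as [h(., y)] is nonzero. *)
Lemma factor_points f h c g (P : C -> Prop) :
  (forall a, f.[a%:P] != 0) -> c *: f = g * h -> c != 0 -> primitive h ->
  (1 < size h)%N -> generic P ->
  generic (fun x => exists y, P y /\ root (at_y y h) x).
Proof.
move=> noV fE c0 prim_h sh [c1 c10 Pc1].
have h0 : h != 0 by apply: contraTneq sh => ->; rewrite size_poly0.
have sYh : sizeY h != 1%N.
  apply/negP => /eqP sYh.
  have /size_poly1P[p p0 pE] : size (swapXY h) == 1%N by rewrite -sizeYE sYh.
  have hE : h = map_poly polyC p by rewrite -(swapXYK h) pE swapXY_polyC.
  have : size p != 1%N by rewrite -(size_map_polyC p) -hE gtn_eqF.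
  move=> /closed_rootP[a /eqP pa].
  have /eqP := congr1 (horner^~ a%:P) fE.
  rewrite /= hornerM hE horner_map /= pa polyC0 mulr0 hornerZ mulf_eq0.
  by rewrite (negPf c0) (negPf (noV a)).
have avoid : generic (fun x => forall b, b \in zeros c1 -> (at_y b h).[x] != 0).
  by apply: generic_all => b _; apply/generic_neq0/prim_h.
have := genericI avoid (generic_lead_coef (swapXY h)).
apply: genericW => x [avoid_x [sz _]].
have /closed_rootP[y hxy] : size (at_y x (swapXY h)) != 1%N.
  by rewrite sz -sizeYE.
rewrite -swapXY_at_y swapXYK in hxy.
exists y; split; last by rewrite /root horner_at_y.
apply: Pc1; apply/negP => c1y.
have /avoid_x : y \in zeros c1 by rewrite mem_zeros.
by rewrite horner_at_y (eqP hxy) eqxx.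
Qed.

End Generic.

(** * A map of tuples is a power of a curve with simple fibres *)

Section PowerStructure.
Context {R : realType}.
Local Notation C := R[i].
Implicit Types (f g h r w : {poly {poly C}}) (p q c : {poly C}) (a b x y : C).

Local Notation at_y y := (map_poly (horner_eval y)).

(** Over the fraction field of [C[y]], [r] is the radical of [f] in [x], and is
    generically the radical of [f(., y)]; [w] is the numerator of the logarithmic
    derivative. *)
Lemma generic_radical f : f != 0 -> exists r w c g,
  [/\ c != 0, c *: f = g * r & coprimep r w] /\
  generic (fun y => forall x, root (at_y y f) x ->
    [/\ root (at_y y r) x, (at_y y r)^`().[x] != 0
      & (at_y y w).[x] = (mup x (at_y y f))%:R * (at_y y r)^`().[x]]).
Proof.
move=> f0; pose g := gcdp f f^`().
have g0 : g != 0 by rewrite gcdp_eq0 (negPf f0).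
have lg0 n : lead_coef g ^+ n != 0 by rewrite expf_neq0 ?lead_coef_eq0.
have fE := Pdiv.Idomain.divpK (dvdp_gcdl f f^`()).
have f'E := Pdiv.Idomain.divpK (dvdp_gcdr f f^`()).
rewrite -/g in fE f'E.
set c1 := lead_coef g ^+ _ in fE; set c2 := lead_coef g ^+ _ in f'E.
have c10 : c1 != 0 by apply: lg0.
have c20 : c2 != 0 by apply: lg0.
pose r := c2 *: (f %/ g); pose w := c1 *: (f^`() %/ g).
have cop : coprimep r w.
  rewrite /r /w coprimepZl // coprimepZr //; apply: coprimep_div_gcd.
  by rewrite f0.
have frw : f^`() * r = f * w.
  apply: (mulIf g0); rewrite /r /w -!scalerAr -!scalerAl -!mulrA.
  by rewrite fE f'E -!scalerAr !scalerA [c2 * c1]mulrC [f * _]mulrC.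
exists r, w, (c2 * c1), g; split.
  by split; rewrite ?mulf_neq0 // /r -scalerAr [g * _]mulrC fE scalerA.
have f_gen : generic (fun y => at_y y f != 0).
  apply: genericW (generic_lead_coef f) => y [sy _].
  by rewrite -size_poly_gt0 sy size_poly_gt0.
apply: genericW (genericI f_gen (coprime_generic cop)) => y [fy copy] x fx.
apply: (logarithmic_derivative fy fx _ (copy x)).
by rewrite deriv_map -!rmorphM frw.
Qed.

(** The first half of the definition of a map of tuples, for points at finite
    distance: the multiplicity of [x] in [f(., y)] does not depend on [y]. *)
Lemma fibre_perm d f x y y' : is_map_of_tuples d f ->
  root (at_y y f) x -> root (at_y y' f) x ->
  perm_eq (sphere_zeros d (at_y y f)) (sphere_zeros d (at_y y' f)).
Proof.
move=> [cf hx _] fy fy'; have [_ [sf sYf] _ _ _] := cf.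
have [sfle sYfle] : (size f <= d.+1)%N /\ (sizeY f <= d.+1)%N.
  by rewrite sf sYf.
have fib b : root (at_y b f) x -> Some b \in fibreY d f (Some x).
  move=> fb; rewrite fibreYE // mem_sphere_zeros; last exact: size_slice.
    by rewrite /= -horner_at_y.
  exact: no_vertical_line cf.
have := hx (Some x) _ _ (fib _ fy) (fib _ fy').
rewrite /fibreX !fibreYE ?sizeYE ?swapXYK -?sizeYE //=.
by rewrite !swapXY_at_y.
Qed.

(** The multiplicity [m] at a point of the curve satisfies [w = m r_x].  As [m] takes
    finitely many values, [w - e r_x] shares a factor [h] with [r] for some [e].
    Almost every [x] lies on [h], where the multiplicity is [e]; since that
    multiplicity depends on [x] only, it is [e] over almost every [y]. *)
Lemma generic_multiplicity d f : is_map_of_tuples d f ->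
  exists e r, [/\ (0 < e)%N, r != 0 & generic (fun y => at_y y f != 0 /\
    forall x, mup x (at_y y f) = (e * mup x (at_y y r))%N /\
              (mup x (at_y y r) <= 1)%N)].
Proof.
move=> tf; have [cf _ _] := tf; have [d1 [sf sYf] _ _ _] := cf.
have noV a : f.[a%:P] != 0 := no_vertical_line a cf.
have f0 : f != 0 by rewrite -size_poly_gt0 sf.
have sf_gt1 : (1 < size f)%N by rewrite sf.
have gen_f := generic_lead_coef f.
have f_neq0 y : size (at_y y f) = size f -> at_y y f != 0.
  by move=> sy; rewrite -size_poly_gt0 sy sf.
have [r [w [c [g [[c0 fE cop] rad]]]]] := generic_radical f0.
have r0 : r != 0.
  apply: contraNneq f0 => r0; move/eqP: fE.
  by rewrite r0 mulr0 scale_poly_eq0 (negPf c0).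
pose W e := w - r^`() *+ e.
have at_yW e y : at_y y (W e) = at_y y w - (at_y y r)^`() *+ e.
  by rewrite rmorphB rmorphMn /= deriv_map.
(* Otherwise, for some y and all e up to the degree of f, r and W e would have no
   common root; but they share a root of f(., y) of multiplicity e. *)
have [e ncop] : exists e, ~~ coprimep r (W e).
  apply: contrapT => /forallNP all_cop.
  have gen_cop : generic (fun y => forall e, e \in iota 0 (size f) ->
      forall x, ~~ (root (at_y y r) x && root (at_y y (W e)) x)).
    by apply: generic_all => e _; apply/coprime_generic/negPn/negP/all_cop.
  have [y [[sy _] [rad_y cop_y]]] :=
    generic_exists (genericI gen_f (genericI rad gen_cop)).
  have /closed_rootP[x fx] : size (at_y y f) != 1%N by rewrite sy gtn_eqF.
  have [rx _ wx] := rad_y x fx.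
  have /cop_y/(_ x) : mup x (at_y y f) \in iota 0 (size f).
    by rewrite mem_iota -sy mup_lt_size ?f_neq0.
  by rewrite rx /root at_yW hornerD hornerN hornerMn wx mulr_natl subrr eqxx.
pose h := gcdp r (W e).
have h_neq0 : h != 0 by rewrite gcdp_eq0 (negPf r0).
have [ch [h0 [ch0 hE prim_h0]]] := primitive_part h_neq0.
have sh0 : (1 < size h0)%N.
  rewrite -(size_scale _ ch0) -hE ltn_neqAle eq_sym size_poly_gt0 h_neq0 andbT.
  exact: ncop.
have [[c1 q1] /= c10 rE] := elimT (Pdiv.Idomain.dvdpP _ _) (dvdp_gcdl r (W e)).
have [[c2 q2] /= c20 WE] := elimT (Pdiv.Idomain.dvdpP _ _) (dvdp_gcdr r (W e)).
rewrite -/h hE -scalerAr scalerAl in rE.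
rewrite -/h hE -scalerAr scalerAl in WE.
have fh : (c1 * c) *: f = (g * (ch *: q1)) * h0.
  by rewrite -scalerA fE scalerAr rE mulrA.
have mup_e : generic (fun y => at_y y f != 0 /\ forall x, root (at_y y h0) x ->
    root (at_y y f) x /\ mup x (at_y y f) = e).
  have cc : c1 * c != 0 by rewrite mulf_neq0.
  have h_fW := genericI (generic_dvd cc fh) (generic_dvd c20 WE).
  have := genericI h_fW (genericI gen_f rad).
  apply: genericW => y [[h_f h_W] [[sy _] rad_y]]; split; first exact: f_neq0.
  move=> x hx; have fx := h_f x hx; split=> //.
  have [_ r'x wx] := rad_y x fx; have /eqP := h_W x hx.
  rewrite at_yW hornerD hornerN hornerMn wx -[_ *+ e]mulr_natl -mulrBl => /eqP.
  by rewrite mulf_eq0 (negPf r'x) orbF subr_eq0 eqr_nat => /eqP.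
have [cx cx0 cxP] := factor_points noV fh (mulf_neq0 c10 c0) prim_h0 sh0 mup_e.
have e_gt0 : (0 < e)%N.
  have [x /cxP[y [[fy hf] /hf[fx <-]]]] := generic_exists (generic_neq0 cx0).
  by rewrite mup_gt0.
(* For almost every y, no root of f(., y) is one of the excluded values of x. *)
have avoid : generic (fun y => forall a, a \in zeros cx -> f.[a%:P].[y] != 0).
  by apply: generic_all => a _; apply/generic_neq0/noV.
exists e, r; split=> //.
have := genericI avoid (genericI (generic_dvd c0 fE) (genericI gen_f rad)).
apply: genericW => y [avoid_y [r_f [[sy _] rad_y]]].
have fy := f_neq0 y sy; split=> // x.
have [fx|nfx] := boolP (root (at_y y f) x); last first.
  rewrite !mupNroot ?muln0 //; exact: contra (r_f x) nfx.
have [rx r'x _] := rad_y x fx; rewrite (mup_simple rx r'x) muln1; split=> //.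
have /cxP[y' [[fy' hf] /hf[fx' <-]]] : cx.[x] != 0.
  apply/negP => cxx; have /avoid_y : x \in zeros cx by rewrite mem_zeros.
  by rewrite -horner_at_y (eqP fx) eqxx.
rewrite -!count_zeros // -!(count_sphere_zeros_Some d).
exact: (permP (fibre_perm tf fx fx')).
Qed.

(** Comparing roots for almost every [y] shows that [f] and [r ^+ e] agree up to
    polynomials in [y]; the constant that remains between primitive polynomials
    is absorbed by an [e]-th root. *)
Lemma map_of_tuples_power d f : is_map_of_tuples d f ->
  exists e g, [/\ (0 < e)%N, f = g ^+ e &
    generic (fun y => forall x, (mup x (at_y y g) <= 1)%N)].
Proof.
move=> tf; have [cf _ _] := tf.
have [e [r [e0 r0 mupE]]] := generic_multiplicity tf.
have gen_r := generic_lead_coef r.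
have r_neq0 y : size (at_y y r) = size r -> at_y y r != 0.
  by move=> sy; rewrite -size_poly_gt0 sy size_poly_gt0.
have fr : lead_coef r ^+ e *: f = lead_coef f *: r ^+ e.
  apply/eqP; rewrite -subr_eq0; apply/eqP/generic_at_y_eq0.
  have := genericI (generic_lead_coef f) (genericI gen_r mupE).
  apply: genericW => y [[_ lf] [[sr lr] [fy mupy]]].
  rewrite rmorphB /= !at_yZ rmorphXn /= horner_exp -lf -lr; apply/eqP.
  rewrite subr_eq0; apply/eqP/pow_of_mup => // [|x]; first exact: r_neq0.
  by have [] := mupy x.
have [c [r1 [c0 rE prim_r1]]] := primitive_part r0.
have prim_f : primitive f.
  by move=> b; rewrite -swapXY_at_y; apply: no_horizontal_line cf.
have prim_r1e : primitive (r1 ^+ e).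
  by move=> b; rewrite rmorphXn; apply/expf_neq0/prim_r1.
have fr1 : lead_coef r ^+ e *: f = (lead_coef f * c ^+ e) *: r1 ^+ e.
  by rewrite fr rE exprZn scalerA.
have lre : lead_coef r ^+ e != 0 by rewrite expf_neq0 ?lead_coef_eq0.
have [k k0 fE] := primitive_proportional prim_f prim_r1e lre fr1.
have rk0 : e.-root k != 0 by rewrite rootC_eq0.
exists e, ((e.-root k)%:P *: r1); split=> //.
  by rewrite exprZn -polyC_exp rootCK.
have := genericI gen_r (genericI (generic_neq0 c0) mupE).
apply: genericW => y [[sr _] [cy [_ mupy]]] x.
have r1y : at_y y r1 != 0 by apply: prim_r1.
have [_] := mupy x; rewrite rE !at_yZ hornerC -!mul_polyC !mupMr ?rootC //.
Qed.

(** Taking an [e]-th power multiplies all multiplicities in the fibres by [e] and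
    leaves the zero set unchanged. *)
Lemma map_of_tuples_root e n g : (0 < e)%N ->
  is_map_of_tuples (e * n) (g ^+ e) -> is_map_of_tuples n g.
Proof.
move=> e0 [[en [sf sYf] _ noV noH] hx hy].
have n0 : (0 < n)%N by move: en; rewrite muln_gt0 => /andP[].
have sg : size g = n.+1 := size_pow_root e0 sf.
have swE : swapXY (g ^+ e) = swapXY g ^+ e by exact: rmorphXn.
have sYg : sizeY g = n.+1.
  by rewrite sizeYE; apply: (size_pow_root e0); rewrite -swE -sizeYE.
have sgs : size (swapXY g) = n.+1 by rewrite -sizeYE.
have sYgs : sizeY (swapXY g) = n.+1 by rewrite sizeYE swapXYK.
have sfs : size (swapXY g ^+ e) = (e * n).+1 by rewrite -swE -sizeYE.
have sYfs : sizeY (swapXY g ^+ e) = (e * n).+1.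
  by rewrite sizeYE -swE swapXYK.
have GE : Gamma n g = Gamma (e * n) (g ^+ e).
  apply/seteqP; split=> -[x y]; rewrite !GammaE ?sg ?sYg ?sf ?sYf //;
    rewrite sliceX ?sg // form_atX ?size_slice ?sYg //.
    by move=> ->; rewrite expr0n eqn0Ngt e0.
  by move=> /eqP; rewrite expf_eq0 => /andP[_ /eqP].
have countY (x z : sphere R) : count_mem z (fibreY (e * n) (g ^+ e) x) =
    (e * count_mem z (fibreY n g x))%N.
  by rewrite fibreYX ?sg ?sYg.
have countX (y z : sphere R) : count_mem z (fibreX (e * n) (g ^+ e) y) =
    (e * count_mem z (fibreX n g y))%N.
  by rewrite /fibreX swE fibreYX ?sgs ?sYgs.
have memY (x z : sphere R) :
    (z \in fibreY n g x) = (z \in fibreY (e * n) (g ^+ e) x).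
  by rewrite -!has_pred1 !has_count countY muln_gt0 e0.
have memX (y z : sphere R) :
    (z \in fibreX n g y) = (z \in fibreX (e * n) (g ^+ e) y).
  by rewrite -!has_pred1 !has_count countX muln_gt0 e0.
split.
- split=> //; try by rewrite GE.
  split; exact: generically_valued.
- move=> x y y'; rewrite !memY => xy /(hx _ _ _ xy)/permP perm_yy'.
  apply/allP => z _ /=; rewrite -(eqn_pmul2l e0) -!countX.
  by rewrite perm_yy'.
move=> y x x'; rewrite !memX => yx /(hy _ _ _ yx)/permP perm_xx'.
apply/allP => z _ /=; rewrite -(eqn_pmul2l e0) -!countY.
by rewrite perm_xx'.
Qed.

Lemma map_of_tuples_simple d f : (0 < d)%N -> is_map_of_tuples d f ->
  (forall (k : nat) g, (k %| d)%N -> k <> d -> is_map_of_tuples k g ->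
     f <> g ^+ (d %/ k)%N) ->
  generic (fun y => uniq (zeros (map_poly (horner_eval y) f))).
Proof.
move=> d0 tf npow; have [e [g [e0 fE simple]]] := map_of_tuples_power tf.
have [[_ [sf sYf] _ _ _] _ _] := tf.
have eE : d = (e * (size g).-1)%N.
  by have := congr1 predn sf; rewrite fE size_exp /= mulnC.
have k0 : (0 < (size g).-1)%N by move: d0; rewrite eE muln_gt0 => /andP[].
have tg : is_map_of_tuples (size g).-1 g.
  by apply: (map_of_tuples_root e0); rewrite -fE -eE.
have e1 : e = 1%N.
  apply: contrapT => /eqP ne1; apply: (npow (size g).-1 g) => //.
  - by rewrite eE dvdn_mull.
  - by apply/eqP; rewrite eE -{1}[(_).-1]mul1n eqn_pmul2r // eq_sym.
  by rewrite eE mulnK.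
have gE : g = f by rewrite fE e1 expr1.
rewrite gE in simple; apply: genericW (genericI (generic_lead_coef f) simple).
move=> y [[sy _] simple_y]; apply: count_mem_uniq => x.
have fy : map_poly (horner_eval y) f != 0 by rewrite -size_poly_gt0 sy sf.
rewrite mem_zeros // count_zeros // -mup_gt0 //.
by case: (mup _ _) (simple_y x) => [|[]].
Qed.

End PowerStructure.

(** * A curve with simple fibres has a matrix of rank two *)

Section RankTwo.
Context {R : realType}.
Local Notation C := R[i].
Implicit Types (f g h : {poly {poly C}}) (p q K L M N : {poly C}) (a b x y c : C).

Local Notation at_y y := (map_poly (horner_eval y)).

(** If these determinants vanish at all natural numbers, they vanish identically;
    then [f(x, y)] is a product [A(x) B(y)], and the roots of [A] give vertical
    lines on the curve. *)
Lemma determinant_points f : (1 < size f)%N -> (forall a, f.[a%:P] != 0) ->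
  exists x1 x2 y1 y2 : C,
    [/\ x1 \is Num.real, x2 \is Num.real, y1 \is Num.real & y2 \is Num.real] /\
    f.[x1%:P].[y1] * f.[x2%:P].[y2] - f.[x1%:P].[y2] * f.[x2%:P].[y1] != 0.
Proof.
move=> sf noV.
have nat_point g : g != 0 -> exists m n : nat, g.[m%:R%:P].[n%:R] != 0.
  move=> g0; have : lead_coef (swapXY g) != 0.
    by rewrite lead_coef_eq0 swapXY_eq0.
  move=> /horner_nat_neq0[m lm]; have : g.[m%:R%:P] != 0.
    rewrite -[g]swapXYK swapXY_at_y -size_poly_gt0 size_map_poly_id0 //.
    by rewrite size_poly_gt0 swapXY_eq0.
  by move=> /horner_nat_neq0[n gn]; exists m, n.
have f0 : f != 0 by apply: contraTneq sf => ->; rewrite size_poly0.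
have [m1 [n1 f11]] := nat_point f f0.
pose g := f.[m1%:R%:P].[n1%:R]%:P *: f -
          f.[m1%:R%:P] *: map_poly polyC (at_y n1%:R f).
have gE x y : g.[x%:P].[y] =
    f.[m1%:R%:P].[n1%:R] * f.[x%:P].[y] - f.[m1%:R%:P].[y] * f.[x%:P].[n1%:R].
  rewrite /g hornerD hornerN !hornerZ horner_map hornerD hornerN !hornerM.
  by rewrite !hornerC horner_at_y.
have [g0|/nat_point[m2 [n2]]] := eqVneq g 0; last first.
  by rewrite gE => D; exists m1%:R, m2%:R, n1%:R, n2%:R; rewrite !realn.
have /closed_rootP[a fa] : size (at_y n1%:R f) != 1%N.
  rewrite -(size_map_polyC (at_y n1%:R f)).
  have f1 : f.[m1%:R%:P] != 0 := noV _.
  rewrite -(size_scale _ f1).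
  have := subr0_eq g0 => <-.
  by rewrite size_scale ?polyC_eq0 // gtn_eqF.
have : f.[m1%:R%:P].[n1%:R] *: f.[a%:P] = 0.
  have := congr1 (horner^~ a%:P) g0.
  rewrite /g /= hornerD hornerN !hornerZ horner_map /= (eqP fa) polyC0.
  by rewrite mulr0 subr0 horner0 mul_polyC.
by move=> /eqP; rewrite scale_poly_eq0 (negPf f11) (negPf (noV a)).
Qed.

(** The right-hand side is [f(., y1)] and [f(., y2)] combined with the coefficients
    given by Cramer's rule from the values at [x1] and [x2]. *)
Lemma rank_two d f x1 x2 y1 y2 : is_map_of_tuples d f ->
  generic (fun y => uniq (zeros (at_y y f))) ->
  let D := f.[x1%:P].[y1] * f.[x2%:P].[y2] - f.[x1%:P].[y2] * f.[x2%:P].[y1] in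
  D != 0 ->
  D%:P *: f =
    (at_y y1 f)^:P *
      (f.[x2%:P].[y2] *: f.[x1%:P] - f.[x1%:P].[y2] *: f.[x2%:P])%:P -
    (at_y y2 f)^:P *
      (f.[x2%:P].[y1] *: f.[x1%:P] - f.[x1%:P].[y1] *: f.[x2%:P])%:P.
Proof.
move=> tf simple D D0; have [cf _ hy] := tf; have [d1 [sf sYf] _ _ _] := cf.
have noV a : f.[a%:P] != 0 := no_vertical_line a cf.
have noH b : at_y b f != 0.
  by rewrite -swapXY_at_y; apply: no_horizontal_line cf.
have le_sf : (size f <= d.+1)%N by rewrite sf.
have le_sYf : (sizeY f <= d.+1)%N by rewrite sYf.
have le_sfs : (size (swapXY f) <= d.+1)%N by rewrite -sizeYE.
have le_sYfs : (sizeY (swapXY f) <= d.+1)%N by rewrite sizeYE swapXYK.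
have size_at b : (size (at_y b f) <= d.+1)%N.
  by rewrite (leq_trans (size_poly _ _)).
have slice_prop x x0 y : root (at_y y f) x -> root (at_y y f) x0 ->
    lead_coef f.[x0%:P] *: f.[x%:P] = lead_coef f.[x%:P] *: f.[x0%:P].
  have fib a : root (at_y y f) a -> Some a \in fibreX d f (Some y).
    move=> fa; rewrite /fibreX fibreYE // mem_sphere_zeros;
      last exact: size_slice.
      by rewrite /= swapXY_at_y.
    by rewrite /= swapXY_at_y.
  move=> fx fx0; have := hy (Some y) _ _ (fib _ fx) (fib _ fx0).
  by rewrite !fibreYE // => /perm_sphere_zeros.
pose K := at_y y1 f; pose L := at_y y2 f.
(* A common root of K and L would make y1 and y2 points of the same fibre, hence K
   and L proportional. *)
have KL_neq0 x0 : ~~ (root K x0 && root L x0).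
  apply/negP => /andP[Kx0 Lx0].
  have /perm_sphere_zeros KL := fibre_perm tf Kx0 Lx0.
  have KLx x : lead_coef L * K.[x] = lead_coef K * L.[x].
    by rewrite -!hornerZ KL.
  have : lead_coef L * D = 0.
    rewrite /D -!horner_at_y -/K -/L mulrBr !mulrA KLx.
    by rewrite [_ * K.[x2]]mulrAC KLx mulrAC subrr.
  by move/eqP; rewrite mulf_eq0 lead_coef_eq0 (negPf (noH y2)) (negPf D0).
apply/eqP; rewrite -subr_eq0; apply/eqP/generic_at_y_eq0.
have := genericI simple (generic_lead_coef f); apply: genericW => y [uy [sy _]].
have at_const p : at_y y p^:P = p.
  rewrite -map_poly_comp map_poly_id // => a _.
  by rewrite /= /horner_eval hornerC.
set N := _ - _ *: f.[x2%:P]; set M := _ - _ *: f.[x2%:P].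
have NE : N.[y] = L.[x2] * (at_y y f).[x1] - L.[x1] * (at_y y f).[x2].
  by rewrite hornerD hornerN !hornerZ !horner_at_y.
have ME : M.[y] = K.[x2] * (at_y y f).[x1] - K.[x1] * (at_y y f).[x2].
  by rewrite hornerD hornerN !hornerZ !horner_at_y.
have DE : D = K.[x1] * L.[x2] - L.[x1] * K.[x2].
  by rewrite /D !horner_at_y.
clearbody D N M.
rewrite rmorphB /= at_yZ rmorphB !rmorphM /= !at_const -/K -/L !map_polyC.
rewrite /= /horner_eval hornerC.
have /closed_rootP[x0 fx0] : size (at_y y f) != 1%N by rewrite sy sf gtn_eqF.
pose P := L.[x0] *: K - K.[x0] *: L.
have sP : (size P <= size (at_y y f))%N.
  rewrite sy sf (leq_trans (size_polyD _ _)) // geq_max size_polyN.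
  by rewrite !(leq_trans (size_scale_leq _ _)) ?size_at.
have Pf : lead_coef (at_y y f) *: P = P`_(size (at_y y f)).-1 *: at_y y f.
  apply: simple_zeros_proportional => // x fx.
  have E := slice_prop x x0 y fx fx0.
  have lx0 : lead_coef f.[x0%:P] != 0 by rewrite lead_coef_eq0.
  rewrite /root /P hornerD hornerN !hornerZ -(inj_eq (mulfI lx0)) mulr0.
  have Kx : lead_coef f.[x0%:P] * K.[x] = lead_coef f.[x%:P] * K.[x0].
    by rewrite !horner_at_y -!hornerZ E.
  have Lx : lead_coef f.[x0%:P] * L.[x] = lead_coef f.[x%:P] * L.[x0].
    by rewrite !horner_at_y -!hornerZ E.
  rewrite mulrBr mulrCA Kx [_ * (K.[x0] * _)]mulrCA Lx subr_eq0.
  by apply/eqP; ring.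
have ly : lead_coef (at_y y f) != 0 by rewrite lead_coef_eq0.
(* The values of K and L at x0 are not both zero, and K, L are independent since
   D is nonzero. *)
have P0 : P != 0.
  apply: contraNneq (KL_neq0 x0) => P0.
  have Px x : L.[x0] * K.[x] = K.[x0] * L.[x].
    apply/eqP; rewrite -subr_eq0 -!hornerZ -hornerN -hornerD -/P P0 horner0 //.
  have KD : K.[x0] * D = 0.
    rewrite DE mulrBr !mulrA.
    have := Px x1; have := Px x2 => P2 P1.
    have -> : K.[x0] * K.[x1] * L.[x2] = K.[x1] * (K.[x0] * L.[x2]) by ring.
    rewrite -P1 -P2; ring.
  have LD : L.[x0] * D = 0.
    rewrite DE mulrBr !mulrA.
    have := Px x1; have := Px x2 => P2 P1.
    have -> : L.[x0] * L.[x1] * K.[x2] = L.[x1] * (L.[x0] * K.[x2]) by ring.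
    rewrite P1 P2; ring.
  move/eqP: KD; rewrite mulf_eq0 (negPf D0) orbF => Kx0.
  by move/eqP: LD; rewrite mulf_eq0 (negPf D0) orbF => Lx0; rewrite /root Kx0.
set c := P`_ _ in Pf.
have c0 : c != 0.
  apply: contraNneq P0 => c0; move/eqP: Pf.
  by rewrite c0 scale0r scaler_eq0 (negPf ly).
(* Both sides agree after multiplication by c, which turns every value of f(., y)
   into a combination of values of K and L. *)
apply/polyP => i; rewrite coef0.
apply: (mulfI c0); rewrite mulr0 !coefB coefZ !coefMC.
have fx x : c * (at_y y f).[x] =
    lead_coef (at_y y f) * (L.[x0] * K.[x] - K.[x0] * L.[x]).
  by rewrite -hornerZ -Pf hornerZ /P hornerD hornerN !hornerZ.
have fi : c * (at_y y f)`_i =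
    lead_coef (at_y y f) * (L.[x0] * K`_i - K.[x0] * L`_i).
  by rewrite -coefZ -Pf coefZ /P coefB !coefZ.
have cN : c * N.[y] =
    L.[x2] * (c * (at_y y f).[x1]) - L.[x1] * (c * (at_y y f).[x2]).
  by rewrite NE; ring.
have cM : c * M.[y] =
    K.[x2] * (c * (at_y y f).[x1]) - K.[x1] * (c * (at_y y f).[x2]).
  by rewrite ME; ring.
have -> : c * (D * (at_y y f)`_i - (K`_i * N.[y] - L`_i * M.[y])) =
    D * (c * (at_y y f)`_i) - (K`_i * (c * N.[y]) - L`_i * (c * M.[y])) by ring.
rewrite cN cM fi !fx DE; ring.
Qed.

Lemma coef_factorisation (K L M N : {poly C}) i j :
  (K^:P * N%:P - L^:P * M%:P)`_i`_j = K`_i * N`_j - L`_i * M`_j.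
Proof. by rewrite !coefB !coefMC !coef_map !coefCM. Qed.

(** A common zero [a] of [K] and [L] would give the line [x = a] on the curve, and
    the degree of [f] in [x] is reached by [K] or [L]. *)
Lemma fractional_degree_of_factorisation d f c (K L M N : {poly C}) :
  (0 < d)%N -> size f = d.+1 -> (forall a, f.[a%:P] != 0) -> c != 0 ->
  c%:P%:P * f = K^:P * N%:P - L^:P * M%:P ->
  (size K <= d.+1)%N -> (size L <= d.+1)%N -> fractional_degree d K L.
Proof.
move=> d0 sf noV c0 fE sK sL.
have f0 : f != 0 by rewrite -size_poly_gt0 sf.
have top : (d.+1 <= maxn (size K) (size L))%N.
  rewrite leqNgt gtn_max; apply/negP => /andP[sKd sLd].
  have : c%:P * lead_coef f = 0.
    have := congr1 (fun g : {poly {poly C}} => g`_d) fE.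
    rewrite /= coefCM coefB !coefMC !coef_map /= lead_coefE sf.
    by rewrite !(nth_default _ sKd, nth_default _ sLd) polyC0 !mul0r subr0.
  by move/eqP; rewrite mulf_eq0 polyC_eq0 lead_coef_eq0 (negPf c0) (negPf f0).
have sg : size (gcdp K L) = 1%N.
  apply/eqP/negPn/negP => /closed_rootP[a]; rewrite root_gcd.
  move=> /andP[/eqP Ka /eqP La].
  have /eqP := congr1 (horner^~ a%:P) fE.
  rewrite /= hornerM hornerC hornerD hornerN !hornerM !horner_map /= Ka La.
  by rewrite polyC0 !mul0r subr0 mulf_eq0 polyC_eq0 (negPf c0) (negPf (noV a)).
have g0 : gcdp K L != 0 by rewrite -size_poly_gt0 sg.
split=> //.
  apply: contra_eq_neq sg => L0; rewrite L0 gcdp0 gtn_eqF //.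
  by move: top; rewrite L0 size_poly0 maxn0; apply: leq_trans.
rewrite /ratmap_degree !size_divp // sg !subn0; apply/eqP.
rewrite -eqSS prednK ?(leq_trans _ top) // eqn_leq top andbT.
by rewrite geq_max sK.
Qed.

(** * Real coefficients *)

Lemma conj_realE (z : C) : (z \is Num.real) = (conjc z == z).
Proof. by rewrite CrealE. Qed.

Definition conjp f := map_poly (map_poly (@conjc R)) f.

Lemma horner_conjp f x y :
  (conjp f).[x%:P].[y] = conjc f.[(conjc x)%:P].[conjc y].
Proof.
rewrite -[in LHS](conjcK x) -[in LHS](conjcK y).
rewrite -[_%:P](map_polyC (@conjc R)) /conjp.
by rewrite horner_map /= horner_map.
Qed.

Definition real_coefs f : Prop := forall i j, f`_i`_j \is Num.real.

Lemma real_horner p x : (forall i, p`_i \is Num.real) -> x \is Num.real ->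
  p.[x] \is Num.real.
Proof.
move=> rp rx; rewrite horner_coef; apply: rpred_sum => i _.
by rewrite rpredM // rpredX.
Qed.

Lemma real_at_y f y j : real_coefs f -> y \is Num.real ->
  (at_y y f)`_j \is Num.real.
Proof. by move=> rf ry; rewrite coef_map; apply: real_horner. Qed.

Lemma real_hornerC f x j : real_coefs f -> x \is Num.real ->
  f.[x%:P]`_j \is Num.real.
Proof.
move=> rf rx; rewrite -[f]swapXYK swapXY_at_y; apply: real_at_y => // k l.
by rewrite coef_swapXY.
Qed.

(** The roots of [f(., y)] are roots of its conjugate; as they are simple for almost
    every [y], the two are proportional, and primitivity makes the factor constant. *)
Lemma real_up_to_constant d f : is_map_of_tuples d f ->
  generic (fun y => uniq (zeros (at_y y f))) ->
  (forall x y, f.[x%:P].[y] = 0 <-> f.[(conjc x)%:P].[conjc y] = 0) ->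
  exists2 c : C, c != 0 & real_coefs (c%:P *: f).
Proof.
move=> tf simple fconj; have [cf _ _] := tf; have [_ [sf _] _ _ _] := cf.
have f0 : f != 0 by rewrite -size_poly_gt0 sf.
have noH : primitive f.
  by move=> b; rewrite -swapXY_at_y; apply: no_horizontal_line cf.
have at_conj y : at_y y (conjp f) = map_poly (@conjc R) (at_y (conjc y) f).
  apply/polyP => i; rewrite !coef_map /= /horner_eval -[in LHS](conjcK y).
  by rewrite horner_map.
have noHc : primitive (conjp f).
  by move=> b; rewrite at_conj map_poly_eq0.
have fc : lead_coef f *: conjp f = (conjp f)`_(size f).-1 *: f.
  apply/eqP; rewrite -subr_eq0; apply/eqP/generic_at_y_eq0.
  have := genericI simple (generic_lead_coef f).
  apply: genericW => y [uy [sy ly]]; rewrite rmorphB /= !at_yZ -ly.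
  apply/eqP; rewrite subr_eq0; apply/eqP.
  have -> : ((conjp f)`_(size f).-1).[y] =
            (at_y y (conjp f))`_(size (at_y y f)).-1.
    by rewrite sy [RHS]coef_map.
  apply: simple_zeros_proportional => //.
    by rewrite sy; apply: leq_trans (size_poly _ _) (size_poly _ _).
  move=> x; rewrite /root !horner_at_y horner_conjp conjc_eq0.
  by move=> /eqP/fconj ->.
have lf0 : lead_coef f != 0 by rewrite lead_coef_eq0.
have [k k0 fk] := primitive_proportional noHc noH lf0 fc.
(* Conjugation multiplies all coefficients by the same k, so their quotients by
   one of them are real. *)
pose a := lead_coef (lead_coef f).
have a0 : a != 0 by rewrite !lead_coef_eq0.
have coefk i j : conjc f`_i`_j = k * f`_i`_j.
  have := congr1 (fun g : {poly {poly C}} => g`_i`_j) fk.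
  by rewrite /= !coef_map coefZ coefCM.
exists a^-1; first by rewrite invr_eq0.
move=> i j; rewrite coefZ coefCM conj_realE.
rewrite rmorphM /= conjc_inv {2}/a /lead_coef !coefk.
by rewrite invfM mulrACA mulVf // mul1r.
Qed.

Lemma factorisation_real d f :  is_map_of_tuples d f ->
  generic (fun y => uniq (zeros (at_y y f))) ->
  (exists2 c : C, c != 0 & real_coefs (c%:P *: f)) ->
  exists K L M N : {poly C}, factorisation d f K L M N /\
    [/\ K \is a polyOver Num.real, L \is a polyOver Num.real,
        M \is a polyOver Num.real & N \is a polyOver Num.real].
Proof.
move=> tf simple [c c0 real_f]; have [cf _ _] := tf.
have [d1 [sf sYf] _ _ _] := cf.
have noV a : f.[a%:P] != 0 := no_vertical_line a cf.
have noH b : (swapXY f).[b%:P] != 0 := no_horizontal_line b cf.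
have sf1 : (1 < size f)%N by rewrite sf.
have [x1 [x2 [y1 [y2 [[rx1 rx2 ry1 ry2]]]]]] := determinant_points sf1 noV.
have := rank_two (x1 := x1) (x2 := x2) (y1 := y1) (y2 := y2) tf simple.
rewrite /=; set D := _ - _ => rank2 D0; have {rank2} fE := rank2 D0.
pose g : {poly {poly C}} := c%:P *: f.
have gE (x : C) : g.[x%:P] = c *: f.[x%:P] by rewrite hornerZ mul_polyC.
pose K := at_y y1 g; pose L := at_y y2 g.
pose N : {poly C} := g.[x2%:P].[y2] *: g.[x1%:P] - g.[x1%:P].[y2] *: g.[x2%:P].
pose M : {poly C} := g.[x2%:P].[y1] *: g.[x1%:P] - g.[x1%:P].[y1] *: g.[x2%:P].
have real_gx x j : x \is Num.real -> g.[x%:P]`_j \is Num.real.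
  exact: real_hornerC.
have real_gxy x y :
    x \is Num.real -> y \is Num.real -> g.[x%:P].[y] \is Num.real.
  by move=> rx ry; apply: real_horner => // j; apply: real_gx.
have size_at y : (size (at_y y g) <= d.+1)%N.
  by rewrite (leq_trans (size_poly _ _)) // size_scale ?polyC_eq0 ?sf.
have size_gx x : (size g.[x%:P] <= d.+1)%N.
  by rewrite gE (leq_trans (size_scale_leq _ _)) // -sYf max_size_evalC.
have size_comb (a b : C) (p q : {poly C}) :
    (size p <= d.+1)%N -> (size q <= d.+1)%N ->
    (size (a *: p - b *: q)%R <= d.+1)%N.
  move=> sp sq; rewrite (leq_trans (size_polyD _ _)) // geq_max size_polyN.
  by rewrite !(leq_trans (size_scale_leq _ _)).
(* The identity of rank_two is cubic in f, and g is c times f. *)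
have E : (c ^+ 3 * D)%:P%:P * f = K^:P * N%:P - L^:P * M%:P.
  apply/polyP => i; apply/polyP => j; rewrite coef_factorisation !coefCM.
  have := congr1 (fun h : {poly {poly C}} => h`_i`_j) fE.
  rewrite /= coef_factorisation coefZ coefCM -mulrA => ->.
  have Ki y : (at_y y g)`_i = c * (at_y y f)`_i.
    by rewrite /g at_yZ hornerC coefZ.
  rewrite /K /L /N /M !Ki !coefB !coefZ !gE !hornerZ !coefZ; ring.
have cD0 : c ^+ 3 * D != 0 by rewrite mulf_neq0 ?expf_neq0.
exists K, L, M, N; split; first split.
- exact: (fractional_degree_of_factorisation d1 sf noV cD0 E
           (size_at _) (size_at _)).
- have Es : (- (c ^+ 3 * D))%:P%:P * swapXY f = M^:P * L%:P - N^:P * K%:P.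
    apply/polyP => i; apply/polyP => j; rewrite coef_factorisation !coefCM.
    have := congr1 (fun h : {poly {poly C}} => h`_j`_i) E.
    rewrite /= coef_factorisation !coefCM coef_swapXY mulNr => ->; ring.
  have ssf : size (swapXY f) = d.+1 by rewrite -sizeYE.
  have cD0' : - (c ^+ 3 * D) != 0 by rewrite oppr_eq0.
  by apply: (fractional_degree_of_factorisation d1 ssf noH cD0' Es);
    apply: size_comb; apply: size_gx.
- by exists (c ^+ 3 * D).
split; apply/polyOverP => j; rewrite ?coefB ?coefZ.
- exact: real_at_y.
- exact: real_at_y.
- by rewrite rpredB // rpredM ?real_gxy ?real_gx.
by rewrite rpredB // rpredM ?real_gxy ?real_gx.
Qed.

Lemma conj_bihom m n f (X Y : C * C) :
  (forall i j, (i <= m)%N -> (j <= n)%N -> f`_i`_j \is Num.real) ->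
  conjc (bihom m n f X Y) =
  bihom m n f (conjc X.1, conjc X.2) (conjc Y.1, conjc Y.2).
Proof.
move=> rf; rewrite rmorph_sum; apply: eq_bigr => i _; rewrite rmorph_sum.
apply: eq_bigr => j _; rewrite !rmorphM !rmorphXn /=.
suff -> : conjc f`_i`_j = f`_i`_j by [].
by have := rf i j (leq_ord i) (leq_ord j); rewrite conj_realE => /eqP.
Qed.

Lemma hcoord_conj (z : sphere R) :
  hcoord (conj_sphere z) = (conjc (hcoord z).1, conjc (hcoord z).2).
Proof.
by case: z => [a|]; congr pair; apply/esym;
  [apply: conjc1 | apply: conjc1 | apply: conjc0].
Qed.

End RankTwo.

Theorem theorem2p6 (R : realType) (d : nat) (f : {poly {poly R[i]}})
    (d_ge2 : (2 <= d)%N)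
    (f_tuples : is_map_of_tuples d f)
    (f_not_power : forall (k : nat) (g : {poly {poly R[i]}}),
       (k %| d)%N -> k <> d -> is_map_of_tuples k g ->
       f <> g ^+ (d %/ k)%N) :
  [<-> (forall x y : sphere R,
          Gamma d f (x, y) <-> Gamma d f (conj_sphere x, conj_sphere y));
       (exists K L M N : {poly R[i]},
          factorisation d f K L M N /\
          [/\ K \is a polyOver Num.real, L \is a polyOver Num.real,
              M \is a polyOver Num.real & N \is a polyOver Num.real]);
       (exists2 c : R[i], c != 0 &
          c *: coef_matrix d f \is a mxOver Num.real)].
Proof.
have d_gt0 : (0 < d)%N := ltnW d_ge2.
have [[_ [sf sYf] _ _ _] _ _] := f_tuples.
have simple := map_of_tuples_simple d_gt0 f_tuples f_not_power.
tfae.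
- move=> Gconj; apply: (factorisation_real f_tuples simple).
  apply: (real_up_to_constant f_tuples simple) => x y.
  by have := Gconj (Some x) (Some y); rewrite !GammaE ?sf ?sYf.
- move=> [K [L [M [N [[_ _ [c c0 fE]]]]]]].
  move=> [/polyOverP rK /polyOverP rL /polyOverP rM /polyOverP rN].
  exists c => //; apply/mxOverP => i j; rewrite !mxE.
  have := congr1 (fun g : {poly {poly R[i]}} => g`_(d - i)`_(d - j)) fE.
  rewrite /= coef_factorisation !coefCM => ->.
  by rewrite rpredB // rpredM.
move=> [c c0 /mxOverP real_mx] x y.
have real_cf i j : (i <= d)%N -> (j <= d)%N ->
    (c%:P *: f)`_i`_j \is Num.real.
  move=> le_id le_jd.
  have := real_mx (rev_ord (inord i)) (rev_ord (inord j)).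
  by rewrite !mxE /= !subSS !inordK ?ltnS // !subKn // coefZ coefCM.
have bihomZ X Y : bihom d d (c%:P *: f) X Y = c * bihom d d f X Y.
  rewrite mulr_sumr; apply: eq_bigr => i _; rewrite mulr_sumr.
  by apply: eq_bigr => j _; rewrite coefZ coefCM !mulrA.
rewrite /Gamma /bihom_zeros /= !hcoord_conj.
have := conj_bihom (hcoord x) (hcoord y) real_cf.
rewrite !bihomZ rmorphM /= => E.
split=> /eqP z0; apply/eqP.
  by rewrite -(mulrI_eq0 _ (mulfI c0)) -E (eqP z0) conjc0 mulr0.
move/eqP: E; rewrite (eqP z0) mulr0 mulf_eq0 !conjc_eq0 (negPf c0) /=.
by [].
Qed.
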